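(* Let $n\ge 1$, let $Q_0,Q_1,Q_2\in\mathcal{S}^n$, $b_0,b_1,b_2\in\mathbb{R}^n$, $c_1,c_2\in\mathbb{R}$, and consider the associated problems (QP), (SP) and (SD) defined in the context. Assume: (A1) (Slater's condition for (SP)) there exists a positive definite $X\in\mathcal{S}^{n+1}$ such that $M(q_i)\bullet X<0$ for $i\in\{1,2\}$ and $I_{00}\bullet X=1$; (A2) (Slater's condition for (SD)) there exist $y_0\in\mathbb{R}$ and $y_1>0$, $y_2>0$ such that $M(q_0)-y_0I_{00}+y_1M(q_1)+y_2M(q_2)\succ 0$. Let $\mathfrak{P}$ be the set of all pairs consisting of an optimal solution $\hat X'$ of (SP) and an optimal solution $(\hat Z',\hat y_0',\hat y_1',\hat y_2')$ of (SD). Then, for any given pair $\hat X$ and $(\hat Z,\hat y_0,\hat y_1,\hat y_2)$ arbitrarily selected from $\mathfrak{P}$, $$\mathcal{V}^*_{(SP)}<\mathcal{V}^*_{(QP)}\quad\text{if and only if the pair } \hat X,\ (\hat Z,\hat y_0,\hat y_1,\hat y_2) \text{ satisfies Property I}^+ .$$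
   Context: Notation: $\mathcal{S}^m$ is the set of real symmetric $m\times m$ matrices; $A\bullet B:=\mathrm{Tr}(AB^T)$; $M\succ 0$ (resp. $M\succeq 0$) means that the symmetric matrix $M$ is positive definite (resp. positive semidefinite). $\mathcal{V}^*_{(P)}$ denotes the optimal value of an optimization problem (P) (for a minimization problem, the infimum of the cost over the feasible set). No definiteness of $Q_0,Q_1,Q_2$ is assumed. Set $$M(q_0)=\begin{bmatrix}0&b_0^T\\ b_0&Q_0\end{bmatrix},\qquad M(q_i)=\begin{bmatrix}c_i&b_i^T\\ b_i&Q_i\end{bmatrix}\ (i\in\{1,2\}),\qquad I_{00}=\begin{bmatrix}1&0_{1\times n}\\ 0_{n\times 1}&0_{n\times n}\end{bmatrix}.$$ Problem (QP): minimize over $z\in\mathbb{R}^n$, $t\in\mathbb{R}$ the cost $z^TQ_0z+2t\,b_0^Tz$ subject to $z^TQ_iz+2t\,b_i^Tz+t^2c_i\le 0$ for $i\in\{1,2\}$ and $t^2=1$. (This is the homogenized form of minimizing $z^TQ_0z+2b_0^Tz$ over $z\in\mathbb{R}^n$ subject to $z^TQ_iz+2b_i^Tz+c_i\le 0$, $i\in\{1,2\}$.) Problem (SP), the semidefinite relaxation: minimize $M(q_0)\bullet X$ over $X\in\mathcal{S}^{n+1}$ subject to $M(q_i)\bullet X\le 0$ for $i\in\{1,2\}$, $I_{00}\bullet X=1$, $X\succeq 0$. Problem (SD), the dual: maximize $y_0$ over $Z\in\mathcal{S}^{n+1}$ and $y_0,y_1,y_2\in\mathbb{R}$ subject to $y_0I_{00}-y_1M(q_1)-y_2M(q_2)+Z=M(q_0)$,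 $y_1\ge 0$, $y_2\ge 0$, $Z\succeq 0$. Property I$^+$: a pair of optimal solutions $\hat X$ of (SP) and $(\hat Z,\hat y_0,\hat y_1,\hat y_2)$ of (SD) has Property I$^+$ if all of the following hold: (i) $\hat y_1\hat y_2\ne 0$; (ii) $\mathrm{rank}(\hat Z)=n-1$; (iii) $\mathrm{rank}(\hat X)=2$; (iv) there exist $\hat x_1,\hat x_2\in\mathbb{R}^{n+1}$ with $\hat X=\hat x_1\hat x_1^T+\hat x_2\hat x_2^T$ such that $M(q_1)\bullet\hat x_i\hat x_i^T=0$ for $i\in\{1,2\}$, $\ (M(q_2)\bullet\hat x_1\hat x_1^T)(M(q_2)\bullet\hat x_2\hat x_2^T)<0$, and $M(q_1)\bullet\hat x_1\hat x_2^T\neq 0$. *)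

(* Defs.v *)
From mathcomp Require Import all_boot all_order all_algebra.
From mathcomp Require Import all_classical all_reals all_analysis.

Set Implicit Arguments.
Unset Strict Implicit.
Unset Printing Implicit Defensive.

Import Order.TTheory GRing.Theory Num.Theory.
Local Open Scope classical_set_scope.
Local Open Scope ring_scope.

Section SymmetricMatrices.
Context {R : realType}.

Definition mxdot m (A B : 'M[R]_m) : R := \tr (A *m B^T).

Definition posdefmx m (A : 'M[R]_m) : Prop :=
  A \is symmetricmx /\
  forall x : 'cV[R]_m, x != 0 -> 0 < (x^T *m A *m x) 0 0.

Definition possemidefmx m (A : 'M[R]_m) : Prop :=
  A \is symmetricmx /\ forall x : 'cV[R]_m, 0 <= (x^T *m A *m x) 0 0.

End SymmetricMatrices.

Section Optimization.
Context {R : realType} {T : Type}.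

(* An infimum in \bar R: it is +oo when the problem is infeasible and -oo when
   the cost is unbounded below. *)
Definition min_value (feasible : set T) (cost : T -> R) : \bar R :=
  ereal_inf [set (cost x)%:E | x in feasible].

Definition minimizer (feasible : set T) (cost : T -> R) (x : T) : Prop :=
  feasible x /\ forall x', feasible x' -> cost x <= cost x'.

Definition maximizer (feasible : set T) (cost : T -> R) (x : T) : Prop :=
  feasible x /\ forall x', feasible x' -> cost x' <= cost x.

End Optimization.

Section Problems.
Context {R : realType} {n : nat}.

(* Index 0 of 'I_(1 + n) is the homogenizing coordinate t. *)
Definition qmx (Q : 'M[R]_n) (b : 'cV[R]_n) (c : R) : 'M[R]_(1 + n) :=
  block_mx c%:M b^T b Q.

Definition I00 : 'M[R]_(1 + n) := block_mx 1%:M 0 0 0.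

(* Points of (QP) are pairs (z, t). *)
Definition qp_cost (Q0 : 'M[R]_n) (b0 : 'cV[R]_n) (p : 'cV[R]_n * R) : R :=
  let: (z, t) := p in
  (z^T *m Q0 *m z) 0 0 + 2 * t * (b0^T *m z) 0 0.

Definition qp_feasible (Q1 Q2 : 'M[R]_n) (b1 b2 : 'cV[R]_n) (c1 c2 : R) :
    set ('cV[R]_n * R) :=
  [set p | let: (z, t) := p in
    [/\ (z^T *m Q1 *m z) 0 0 + 2 * t * (b1^T *m z) 0 0 + t ^+ 2 * c1 <= 0,
        (z^T *m Q2 *m z) 0 0 + 2 * t * (b2^T *m z) 0 0 + t ^+ 2 * c2 <= 0
      & t ^+ 2 = 1]].

Definition sp_cost (M0 X : 'M[R]_(1 + n)) : R := mxdot M0 X.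

Definition sp_feasible (M1 M2 : 'M[R]_(1 + n)) : set 'M[R]_(1 + n) :=
  [set X | [/\ mxdot M1 X <= 0, mxdot M2 X <= 0, mxdot I00 X = 1
             & possemidefmx X]].

Definition sd_cost (d : 'M[R]_(1 + n) * R * R * R) : R :=
  let: (_, y0, _, _) := d in y0.

Definition sd_feasible (M0 M1 M2 : 'M[R]_(1 + n)) :
    set ('M[R]_(1 + n) * R * R * R) :=
  [set d | let: (Z, y0, y1, y2) := d in
    [/\ y0 *: I00 - y1 *: M1 - y2 *: M2 + Z = M0,
        0 <= y1, 0 <= y2 & possemidefmx Z]].

Definition optimal_pairs (M0 M1 M2 : 'M[R]_(1 + n)) :
    set ('M[R]_(1 + n) * ('M[R]_(1 + n) * R * R * R)) :=
  [set p | minimizer (sp_feasible M1 M2) (sp_cost M0) p.1 /\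
           maximizer (sd_feasible M0 M1 M2) sd_cost p.2].

Definition property_Iplus (M1 M2 : 'M[R]_(1 + n))
    (p : 'M[R]_(1 + n) * ('M[R]_(1 + n) * R * R * R)) : Prop :=
  let: (X, (Z, _, y1, y2)) := p in
  [/\ y1 * y2 != 0,
      \rank Z = (n - 1)%N,
      \rank X = 2%N
    & exists x1 x2 : 'cV[R]_(1 + n),
      [/\ X = x1 *m x1^T + x2 *m x2^T,
          mxdot M1 (x1 *m x1^T) = 0 /\ mxdot M1 (x2 *m x2^T) = 0,
          mxdot M2 (x1 *m x1^T) * mxdot M2 (x2 *m x2^T) < 0
        & mxdot M1 (x1 *m x2^T) != 0]].

End Problems.

(* Main.v *)
Require Import Defs.
From mathcomp Require Import all_boot all_order all_algebra.
From mathcomp Require Import all_classical all_reals all_analysis.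
From mathcomp Require Import ring lra.

Set Implicit Arguments.
Unset Strict Implicit.
Unset Printing Implicit Defensive.

Import Order.TTheory GRing.Theory Num.Theory.
Import numFieldNormedType.Exports.
Local Open Scope classical_set_scope.
Local Open Scope ring_scope.

(** By Slater's condition for (SP), strong duality holds, so every optimal pair
    satisfies [Z X = 0] and [y_i (M_i . X) = 0].  A nonzero [x] in the kernel of [Z]
    with [x^T M_i x <= 0] and [y_i (x^T M_i x) = 0] gives, after rescaling, a point of
    (QP) with the value of (SP); Slater's condition for (SD) forces its first
    coordinate to be nonzero.  A positive gap thus means that no such [x] exists.
    Then [y_1, y_2 <> 0], by the rank-one decomposition of Sturm and Zhang applied
    to [X], and decomposing [X] into [M_1]-isotropic vectors yields [p], [q] in
    [ker Z] on which [M_2] has opposite signs.  If [ker Z] contained a third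
    independent vector, the cone [M_1 = 0] would contain a curve joining [p] to a
    multiple of [q], hence a common zero of [M_1] and [M_2]; so [ker Z] is spanned by
    [p] and [q].  Conversely, under Property I+ the kernel of [Z] contains no
    nonzero common zero of [M_1] and [M_2], and the gap is bounded below by
    compactness, Slater's condition for (SD) making the sublevel sets of (QP)
    bounded. *)

(** * Bilinear forms, sums of outer products and positive semidefinite matrices *)

Section BilinearForms.
Context {R : realType} {m : nat}.
Implicit Types (A M X Y Z : 'M[R]_m) (x y w : 'cV[R]_m) (a b : R).

Definition bform M x y : R := (x^T *m M *m y) 0 0.

Lemma symmetricmxP M : reflect (M^T = M) (M \is symmetricmx).
Proof.
apply: (iffP (is_hermitianmxP _ _ _)) => /=; rewrite expr0 scale1r map_mx_id //.
Qed.

Lemma bformDl M x y w : bform M (x + y) w = bform M x w + bform M y w.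
Proof. by rewrite /bform linearD /= !mulmxDl mxE. Qed.

Lemma bformZl M a x y : bform M (a *: x) y = a * bform M x y.
Proof. by rewrite /bform linearZ /= -!scalemxAl mxE. Qed.

Lemma bformDr M x y w : bform M w (x + y) = bform M w x + bform M w y.
Proof. by rewrite /bform mulmxDr mxE. Qed.

Lemma bformZr M a x y : bform M x (a *: y) = a * bform M x y.
Proof. by rewrite /bform -scalemxAr mxE. Qed.

Lemma bformDm M N x y : bform (M + N) x y = bform M x y + bform N x y.
Proof. by rewrite /bform mulmxDr mulmxDl mxE. Qed.

Lemma bformNm M x y : bform (- M) x y = - bform M x y.
Proof. by rewrite /bform mulmxN mulNmx mxE. Qed.

Lemma bformZm a M x y : bform (a *: M) x y = a * bform M x y.
Proof. by rewrite /bform -scalemxAr -scalemxAl mxE. Qed.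

Lemma bformC M x y : M^T = M -> bform M x y = bform M y x.
Proof.
move=> sM; rewrite /bform -[in RHS](trmxK (y^T *m M *m x)) [in RHS]mxE.
by rewrite !trmx_mul trmxK sM mulmxA.
Qed.

Lemma qform_comb M a b x y : M^T = M ->
  bform M (a *: x + b *: y) (a *: x + b *: y)
  = a ^+ 2 * bform M x x + 2 * a * b * bform M x y + b ^+ 2 * bform M y y.
Proof.
move=> sM; rewrite !(bformDl, bformDr, bformZl, bformZr) (bformC y x sM).
ring.
Qed.

Lemma qform0 M : bform M 0 0 = 0.
Proof. by rewrite /bform mulmx0 mxE. Qed.

Lemma bform_kerr M x y : M *m y = 0 -> bform M x y = 0.
Proof. by move=> My; rewrite /bform -mulmxA My mulmx0 mxE. Qed.

Lemma mxdotDl M N X : mxdot (M + N) X = mxdot M X + mxdot N X.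
Proof. by rewrite /mxdot mulmxDl linearD. Qed.

Lemma mxdotNl M X : mxdot (- M) X = - mxdot M X.
Proof. by rewrite /mxdot mulNmx linearN. Qed.

Lemma mxdotZl a M X : mxdot (a *: M) X = a * mxdot M X.
Proof. by rewrite /mxdot -scalemxAl linearZ. Qed.

Lemma mxdotDr M X Y : mxdot M (X + Y) = mxdot M X + mxdot M Y.
Proof. by rewrite /mxdot linearD mulmxDr linearD. Qed.

Lemma mxdotZr a M X : mxdot M (a *: X) = a * mxdot M X.
Proof. by rewrite /mxdot linearZ -scalemxAr linearZ. Qed.

Lemma mxdot0r M : mxdot M 0 = 0.
Proof. by rewrite /mxdot linear0 mulmx0 linear0. Qed.

Lemma mxdot_outer M x y : mxdot M (x *m y^T) = bform M x y.
Proof.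
by rewrite /mxdot /bform trmx_mul trmxK mulmxA mxtrace_mulC mulmxA /mxtrace big_ord1.
Qed.

Definition gram (ps : seq 'cV[R]_m) : 'M[R]_m := \sum_(p <- ps) p *m p^T.

Lemma mxdot_gram M ps : mxdot M (gram ps) = \sum_(p <- ps) bform M p p.
Proof.
rewrite /gram; elim: ps => [|p ps IH]; first by rewrite !big_nil mxdot0r.
by rewrite !big_cons mxdotDr mxdot_outer IH.
Qed.

Lemma rank_gram ps : (\rank (gram ps) <= size ps)%N.
Proof.
rewrite /gram; elim: ps => [|p ps IH]; first by rewrite big_nil mxrank0.
rewrite big_cons (leq_trans (mxrank_add _ _)) //=.
apply: (@leq_add _ _ 1) => //; exact: leq_trans (mxrankM_maxl _ _) (rank_leq_col _).
Qed.

Lemma gram_perm ps qs : perm_eq ps qs -> gram ps = gram qs.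
Proof. by move=> e; rewrite /gram (perm_big _ e). Qed.

(** Deleting a zero vector would leave the sum unchanged with fewer vectors than its rank, against
    [rank_gram]. *)
Lemma gram_nonzero ps p : size ps = \rank (gram ps) -> p \in ps -> p != 0.
Proof.
move=> sz pin; apply/eqP => p0.
have pe := perm_to_rem pin; have := rank_gram (rem p ps).
have -> : gram (rem p ps) = gram ps.
  by rewrite (gram_perm pe) /gram big_cons p0 mul0mx add0r.
by rewrite -sz (perm_size pe) /= ltnn.
Qed.

Lemma psd_sym Z : possemidefmx Z -> Z^T = Z.
Proof. by case=> /symmetricmxP. Qed.

Lemma psdP Z : Z^T = Z -> (forall x, 0 <= bform Z x x) -> possemidefmx Z.
Proof. by move=> s h; split => //; exact/symmetricmxP. Qed.

Lemma psd_outer x : possemidefmx (x *m x^T).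
Proof.
apply: psdP => [|y]; first by rewrite trmx_mul trmxK.
rewrite /bform mulmxA -mulmxA mxE big_ord1.
rewrite (_ : (x^T *m y) 0 0 = (y^T *m x) 0 0) -?expr2 ?sqr_ge0 //.
by rewrite -[in RHS](trmxK (y^T *m x)) [in RHS]mxE trmx_mul trmxK.
Qed.

Lemma psdD X Y : possemidefmx X -> possemidefmx Y -> possemidefmx (X + Y).
Proof.
move=> hX hY; apply: psdP; first by rewrite linearD /= !psd_sym.
by move=> x; rewrite bformDm addr_ge0 ?hX.2 ?hY.2.
Qed.

Lemma psdZ a X : 0 <= a -> possemidefmx X -> possemidefmx (a *: X).
Proof.
move=> a0 hX; apply: psdP; first by rewrite linearZ /= psd_sym.
by move=> x; rewrite bformZm mulr_ge0 ?hX.2.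
Qed.

Lemma posdef_psd X : posdefmx X -> possemidefmx X.
Proof.
move=> [sX hX]; split=> // x; have [->|/hX/ltW//] := eqVneq x 0.
by rewrite [leRHS]qform0.
Qed.

Lemma gram_psd ps : possemidefmx (gram ps).
Proof.
rewrite /gram; elim: ps => [|p ps IH].
  rewrite big_nil; apply: psdP; first by rewrite trmx0.
  by move=> x; rewrite /bform mulmx0 mul0mx mxE.
by rewrite big_cons; apply: psdD => //; exact: psd_outer.
Qed.

Lemma bform_delta Z x i : bform Z (delta_mx i 0) x = (Z *m x) i 0.
Proof. by rewrite /bform -mulmxA trmx_delta -rowE mxE. Qed.

Lemma affine_nonneg (a b : R) : (forall s, 0 <= s -> 0 <= a + s * b) -> 0 <= b.
Proof.
move=> h; rewrite leNgt; apply/negP => b0.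
have a0 : 0 <= a by have := h 0 (lexx _); rewrite mul0r addr0.
have s0 : 0 <= (a + 1) / - b by rewrite divr_ge0 //; lra.
have := h _ s0; rewrite (_ : _ * b = - (a + 1)); last by field; lra.
lra.
Qed.

(** Since [x] is isotropic, the form along [e + s *: x] is affine in [s]. Being nonnegative for
    every real [s], it has slope zero, and this slope is twice a coordinate of [Z *m x]. *)
Lemma psd_ker Z x : possemidefmx Z -> bform Z x x = 0 -> Z *m x = 0.
Proof.
move=> hZ qx; apply/matrixP => i j; rewrite ord1 -bform_delta mxE.
set e := delta_mx i 0.
have key s : 0 <= bform Z e e + s * (2 * bform Z e x).
  have := hZ.2 (1 *: e + s *: x); rewrite -/(bform _ _ _).
  by rewrite qform_comb ?psd_sym // qx; move=> ?; lra.
have h1 : 0 <= 2 * bform Z e x by apply: affine_nonneg => s _; exact: key.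
have h2 : 0 <= - (2 * bform Z e x).
  by apply: (@affine_nonneg (bform Z e e)) => s _; have := key (- s); lra.
lra.
Qed.

Lemma psd_gram_ker Z ps p : possemidefmx Z -> mxdot Z (gram ps) = 0 ->
  p \in ps -> Z *m p = 0.
Proof.
move=> hZ; rewrite mxdot_gram => /eqP.
rewrite psumr_eq0 => [/allP h pin|q _]; last exact: hZ.2.
by apply: psd_ker => //; apply/eqP; exact: h.
Qed.

Lemma psd_diag_gt0 X : possemidefmx X -> X != 0 -> exists i, 0 < X i i.
Proof.
move=> hX; apply: contra_neqP => /forallNP h; apply/matrixP => i j.
have Xe k : bform X (delta_mx k 0) (delta_mx k 0) = X k k.
  by rewrite bform_delta -colE mxE.
have /(psd_ker hX)/matrixP/(_ i 0) : bform X (delta_mx j 0) (delta_mx j 0) = 0.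
  apply/le_anti; rewrite [X in _ && X]hX.2 andbT Xe leNgt.
  exact/negP/h.
by rewrite -colE !mxE.
Qed.

(* Schur complement at a positive diagonal entry: it kills [delta_mx i 0],
   which strictly lowers the rank. *)
Lemma psd_deflate X i (p := (Num.sqrt (X i i))^-1 *: col i X) :
  possemidefmx X -> 0 < X i i ->
  possemidefmx (X - p *m p^T) /\ (\rank (X - p *m p^T)%R < \rank X)%N.
Proof.
move=> hX Xii; have sX := psd_sym hX.
set e : 'cV[R]_m := delta_mx i 0.
have ppE : p *m p^T = (X i i)^-1 *: ((X *m e) *m (X *m e)^T).
  rewrite /p colE linearZ /= -scalemxAl -scalemxAr scalerA -invrM ?unitf_gt0 ?sqrtr_gt0 //.
  by rewrite -expr2 sqr_sqrtr // ltW.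
have eXe : e^T *m X *m e = (X i i)%:M.
  by apply/matrixP => a b; rewrite !ord1 -/(bform X e e) bform_delta -colE !mxE eqxx.
have eY : e^T *m (X - p *m p^T) = 0.
  rewrite mulmxBr ppE -scalemxAr mulmxA (mulmxA e^T) eXe mul_scalar_mx.
  rewrite scalerA mulVf ?gt_eqF // scale1r trmx_mul sX; exact: subrr.
split.
  apply: psdP; first by rewrite linearB /= trmx_mul trmxK sX.
  (* This multiple of [e] minimizes the form of [X] on the line, and the minimum is the form of the
     Schur complement at [x]. *)
  move=> x; have := hX.2 (1 *: x + (- (bform X e x / X i i)) *: e).
  rewrite -/(bform _ _ _) qform_comb // (bformC x e sX).
  rewrite bformDm bformNm ppE bformZm.
  have -> : bform X e e = X i i by rewrite /bform eXe mxE eqxx.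
  have -> : bform (X *m e *m (X *m e)^T) x x = bform X e x ^+ 2.
    rewrite /bform mulmxA -mulmxA mxE big_ord1 expr2; congr (_ * _).
      by rewrite mulmxA -/(bform _ _ _) bformC.
    by rewrite trmx_mul sX.
  set k := bform X e x; move=> h.
  have -> : bform X x x - (X i i)^-1 * k ^+ 2
   = 1 ^+ 2 * bform X x x + 2 * 1 * - (k / X i i) * k + (- (k / X i i)) ^+ 2 * X i i.
    by field; rewrite gt_eqF.
  by [].
have sub : (X - p *m p^T <= X)%MS.
  rewrite addmx_sub // -scaleN1r scalemx_sub // ppE scalemx_sub //.
  by rewrite trmx_mul sX mulmxA submxMl.
rewrite ltn_neqAle mxrankS // andbT; apply/negP => /eqP rk.
have : (X <= X - p *m p^T)%MS by rewrite -(mxrank_leqif_sup sub) rk.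
case/submxP => D XD; have sY : (X - p *m p^T)^T = X - p *m p^T.
  by rewrite linearB /= trmx_mul trmxK sX.
have : e^T *m X *m e = 0.
  by rewrite {1}XD mulmxA -mulmxA -{1}sY -[e]trmxK -trmx_mul eY trmx0 mulmx0.
by rewrite eXe => /matrixP/(_ 0 0); rewrite !mxE eqxx => /eqP; rewrite gt_eqF.
Qed.

(** Repeated deflation: the strict drop of the rank bounds the number of vectors from above,
    [rank_gram] from below. *)
Lemma psd_gram X : possemidefmx X -> exists ps, size ps = \rank X /\ X = gram ps.
Proof.
have [k] := ubnP (\rank X); elim: k X => // k IH X rX hX.
have [->|X0] := eqVneq X 0.
  by exists [::]; rewrite mxrank0 /gram big_nil.
have [i Xii] := psd_diag_gt0 hX X0.
have [hY rY] := psd_deflate hX Xii.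
set p := _ *: col i X in hY rY.
have [||ps [sps Yps]] := IH (X - p *m p^T) => //; first by rewrite (leq_trans rY).
have XE : X = gram (p :: ps).
  by rewrite /gram big_cons -/(gram ps) -Yps addrCA subrr addr0.
exists (p :: ps); split => //; apply/eqP.
by rewrite eqn_leq /= {1}sps rY /= {1}XE; exact: rank_gram.
Qed.

End BilinearForms.

(** * Rank-one decompositions and common zeros of two quadratic forms *)

Section CommonZeros.
Context {R : realType} {m : nat}.
Implicit Types (M X Z : 'M[R]_m) (p q w x y : 'cV[R]_m) (ps : seq 'cV[R]_m).

Lemma quadratic_root (a b c : R) : a < 0 -> 0 < c ->
  exists s, a + 2 * s * b + s ^+ 2 * c = 0.
Proof.
move=> a0 c0; set d := Num.sqrt (b ^+ 2 - a * c).
have hd : d ^+ 2 = b ^+ 2 - a * c.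
  by rewrite sqr_sqrtr // subr_ge0 (le_trans _ (sqr_ge0 _)) // nmulr_rle0 // ltW.
exists ((d - b) / c).
transitivity ((d ^+ 2 - (b ^+ 2 - a * c)) / c); first by field; rewrite gt_eqF.
by rewrite hd subrr mul0r.
Qed.

(** Rotating the pair [p], [q] preserves the sum of outer products. The tangent [s] of the angle
    solves the quadratic equation expressing that the form equals [d] at
    [(p + s q) / sqrt (1 + s^2)]. *)
Lemma rotate_outer M (d : R) p q : M^T = M -> bform M p p < d -> d < bform M q q ->
  exists x y, x *m x^T + y *m y^T = p *m p^T + q *m q^T /\ bform M x x = d.
Proof.
move=> sM pd dq.
have [||s hs] := @quadratic_root (bform M p p - d) (bform M p q) (bform M q q - d).
- by rewrite subr_lt0.
- by rewrite subr_gt0.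
have n0 : 0 < 1 + s ^+ 2 by rewrite ltr_pwDl // sqr_ge0.
set r := Num.sqrt (1 + s ^+ 2); have r0 : 0 < r by rewrite sqrtr_gt0.
have r2 : r ^+ 2 = 1 + s ^+ 2 by rewrite sqr_sqrtr // ltW.
exists (r^-1 *: p + (s / r) *: q), ((- (s / r)) *: p + r^-1 *: q); split.
  rewrite !linearD !linearZ /= !(mulmxDl, mulmxDr) -?scalemxAl -?scalemxAr.
  rewrite -[s *: _]/(s * _).
  move: (p *m p^T) (q *m p^T) (p *m q^T) (q *m q^T) => A B C D.
  apply/matrixP => i j; rewrite !mxE.
  transitivity ((1 + s ^+ 2) / r ^+ 2 * (A i j + D i j)).
    by field; rewrite gt_eqF.
  by rewrite r2 divff ?mul1r // gt_eqF.
rewrite qform_comb //.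
have -> : r^-1 ^+ 2 * bform M p p + 2 * r^-1 * (s / r) * bform M p q
   + (s / r) ^+ 2 * bform M q q
  = (bform M p p + 2 * s * bform M p q + s ^+ 2 * bform M q q) / r ^+ 2.
  by field; rewrite gt_eqF.
rewrite (_ : _ + _ = d * (1 + s ^+ 2)); last by lra.
by rewrite r2 mulfK // gt_eqF.
Qed.

(* The rank-one decomposition of Sturm and Zhang. *)
Lemma equalize_gram M (d : R) ps : M^T = M ->
  \sum_(p <- ps) (bform M p p - d) = 0 ->
  exists qs, [/\ size qs = size ps, gram qs = gram ps
    & forall q, q \in qs -> bform M q q = d].
Proof.
move=> sM; have [k] := ubnP (size ps); elim: k ps => // k IH [|p ps] /=.
  by move=> _ _; exists [::].
rewrite ltnS => sk; rewrite big_cons => h.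
have [ed|nd] := eqVneq (bform M p p) d.
  have [||qs [sq gq hq]] := IH ps => //; first by move: h; rewrite ed subrr add0r.
  exists (p :: qs); split=> /=; first by rewrite sq.
    by move: gq; rewrite /gram !big_cons => ->.
  by move=> q; rewrite inE => /orP[/eqP->|/hq].
(* The values average to [d], so some [q] lies on the other side of [d] from [p]; rotating this pair
   creates a vector of value exactly [d]. *)
have [q qin [x [y [xy xd]]]] : exists2 q, q \in ps & exists x y,
    x *m x^T + y *m y^T = p *m p^T + q *m q^T /\ bform M x x = d.
  have [pd|dp] : bform M p p < d \/ d < bform M p p.
    by apply/orP; rewrite -neq_lt.
    have [q qin dq] : exists2 q, q \in ps & d < bform M q q.
      apply: contrapT => nq; suff : \sum_(q <- ps) (bform M q q - d) <= 0 by lra.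
      rewrite big_seq sumr_le0 // => q qin; rewrite subr_le0 leNgt.
      by apply/negP => dq; apply: nq; exists q.
    by exists q => //; exact: rotate_outer.
  have [q qin dq] : exists2 q, q \in ps & bform M q q < d.
    apply: contrapT => nq; suff : 0 <= \sum_(q <- ps) (bform M q q - d) by lra.
    rewrite big_seq sumr_ge0 // => q qin; rewrite subr_ge0 leNgt.
    by apply/negP => dq; apply: nq; exists q.
  by exists q => //; rewrite addrC; exact: rotate_outer.
have pe := perm_to_rem qin.
have gE : gram (p :: ps) = x *m x^T + gram (y :: rem q ps).
  rewrite /gram big_cons (perm_big _ pe) !big_cons !addrA.
  by rewrite xy.
have [||qs [sq gq hq]] := IH (y :: rem q ps).
- by move: sk; rewrite (perm_size pe).
(* The pairing of [M] with the whole sum is unchanged, so removing [x], of value [d], leaves the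
   other values with mean [d]. *)
- have := congr1 (mxdot M) gE; rewrite mxdotDr mxdot_outer !mxdot_gram xd big_cons.
  move: h; rewrite !big_split !big_cons /= !sumrN !big_const_seq !count_predT.
  rewrite !iter_addr !addr0 (perm_size pe) /= !mulrS; lra.
exists (x :: qs); split=> /=; first by rewrite sq (perm_size pe).
  by rewrite gE -gq /gram !big_cons.
by move=> z; rewrite inE => /orP[/eqP->|/hq].
Qed.

(** [M] vanishes on the whole plane of [x] and [y], so any zero of [N] on the line [x + s *: y] will
    do. This line avoids the origin because [N] has opposite signs at [x] and [y]. *)
Lemma common_zero_plane M N x y : M^T = M -> N^T = N ->
  bform M x x = 0 -> bform M y y = 0 -> bform M x y = 0 ->
  bform N x x < 0 -> 0 < bform N y y ->
  exists s, [/\ x + s *: y != 0, bform M (x + s *: y) (x + s *: y) = 0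
    & bform N (x + s *: y) (x + s *: y) = 0].
Proof.
move=> sM sN Mx My Mxy Nx Ny.
have [s hs] := quadratic_root (bform N x y) Nx Ny.
exists s; rewrite -[x]scale1r !qform_comb // Mx My Mxy; split; last 2 first.
- by rewrite !mulr0 !addr0.
- by rewrite -[RHS]hs; ring.
rewrite scale1r; apply/eqP => /eqP; rewrite addr_eq0 => /eqP xE.
move: Nx; rewrite xE -scaleNr bformZl bformZr mulrA -expr2 sqrrN ltNge.
by rewrite mulr_ge0 ?sqr_ge0 ?ltW.
Qed.

Lemma qform_comb3 M (a b c : R) x y w : M^T = M ->
  bform M (a *: x + b *: y + c *: w) (a *: x + b *: y + c *: w)
  = a ^+ 2 * bform M x x + b ^+ 2 * bform M y y + c ^+ 2 * bform M w w
    + 2 * a * b * bform M x y + 2 * a * c * bform M x w + 2 * b * c * bform M y w.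
Proof.
move=> sM; rewrite !(bformDl, bformDr, bformZl, bformZr).
rewrite (bformC y x sM) (bformC w x sM) (bformC w y sM); ring.
Qed.

(* Once [w] is replaced by a vector orthogonal to [p] and [q] for [M], the zero
   set of [M] in the 3-space contains a connected curve joining [p] to a multiple
   of [q], along which [N] changes sign. *)
Lemma common_zero_space M N p q w : M^T = M -> N^T = N ->
  bform M p p = 0 -> bform M q q = 0 -> bform M p q != 0 ->
  bform N p p < 0 -> 0 < bform N q q ->
  (forall a b : R, w != a *: p + b *: q) ->
  exists a b c : R, let x := a *: p + b *: q + c *: w in
    [/\ x != 0, bform M x x = 0 & bform N x x = 0].
Proof.
move=> sM sN Mp Mq beta0 Np Nq indep; set beta := bform M p q in beta0.
set a0 := - (bform M q w / beta); set b0 := - (bform M p w / beta).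
set v := a0 *: p + b0 *: q + 1 *: w.
have vE a b c : a *: p + b *: q + c *: v
    = (a + c * a0) *: p + (b + c * b0) *: q + c *: w.
  by apply/matrixP => i j; rewrite !mxE; ring.
suff [a [b [c H]]] : exists a b c : R, let x := a *: p + b *: q + c *: v in
    [/\ x != 0, bform M x x = 0 & bform N x x = 0].
  by exists (a + c * a0), (b + c * b0), c; rewrite -vE.
have nz a b c : c != 0 -> a *: p + b *: q + c *: v != 0.
  move=> c0; rewrite vE; apply: contraTneq isT => /eqP; rewrite addrC addr_eq0.
  move=> /eqP cw; have := indep (- (a + c * a0) / c) (- (b + c * b0) / c).
  rewrite -(scalerK c0 w) cw opprD scalerDr -!scaleNr !scalerA.
  by rewrite [c^-1 * _]mulrC [c^-1 * - (b + _)]mulrC eqxx.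
have Mpv : bform M p v = 0.
  rewrite /v !bformDr !bformZr Mp -/beta /b0; field.
  by [].
have Mqv : bform M q v = 0.
  rewrite /v !bformDr !bformZr Mq (bformC q p sM) -/beta /a0; field.
  by [].
have vv : 0 *: p + 0 *: q + 1 *: v = v by rewrite !scale0r !add0r scale1r.
(* If [v] is isotropic, [M] vanishes on the plane of [v] and [p] and on that of [v] and [q]; the
   sign of [N] at [v] selects one of them. *)
have [g0|g0] := eqVneq (bform M v v) 0.
  have [Nv|Nv|Nv] := ltgtP (bform N v v) 0.
  - have [|s [x0 Mx Nx]] := common_zero_plane sM sN g0 Mq _ Nv Nq.
      by rewrite bformC.
    exists 0, s, 1; rewrite (_ : _ + _ = v + s *: q) //.
    by rewrite scale0r add0r scale1r addrC.
  - have [s [x0 Mx Nx]] := common_zero_plane sM sN Mp g0 Mpv Np Nv.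
    exists 1, 0, s; rewrite (_ : _ + _ = p + s *: v) //.
    by rewrite scale0r addr0 scale1r.
  - exists 0, 0, 1 => /=; rewrite vv; split=> //.
    by rewrite -vv nz // oner_eq0.
(* On the curve [(1 - s)^2 p + k s^2 q + s (1 - s) v] the form [M] equals
   [s^2 (1 - s)^2 (2 k beta + g)], which this [k] makes zero. [P] is [N] along the curve, which runs
   from [p] to [k q]. *)
set g := bform M v v in g0; set k := - (g / (2 * beta)).
have k0 : k != 0 by rewrite oppr_eq0 mulf_neq0 // invr_eq0 mulf_neq0 // pnatr_eq0.
pose P : {poly R} := (1 - 'X) ^+ 4 * (bform N p p)%:P
  + 'X ^+ 4 * (k ^+ 2 * bform N q q)%:P + ('X * (1 - 'X)) ^+ 2 * (bform N v v)%:P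
  + (1 - 'X) ^+ 2 * 'X ^+ 2 * (2 * k * bform N p q)%:P
  + (1 - 'X) ^+ 3 * 'X * (2 * bform N p v)%:P
  + 'X ^+ 3 * (1 - 'X) * (2 * k * bform N q v)%:P.
have PE s : P.[s] = let x := (1 - s) ^+ 2 *: p + (k * s ^+ 2) *: q
    + (s * (1 - s)) *: v in bform N x x.
  by rewrite /= qform_comb3 // /P !hornerE /=; ring.
have [|s s01 /rootP Ps] := @poly_ivt _ P 0 1 ler01.
  apply/andP; split; rewrite PE /=.
    rewrite expr0n mulr0 mul0r subr0 expr1n !scale0r !addr0 scale1r; exact: ltW.
  rewrite subrr expr0n expr1n mulr1 mul1r !scale0r add0r addr0.
  by rewrite bformZl bformZr mulrA -expr2 mulr_ge0 ?sqr_ge0 // ltW.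
exists ((1 - s) ^+ 2), (k * s ^+ 2), (s * (1 - s)); split; last 2 first.
- rewrite qform_comb3 // Mp Mq Mpv Mqv -/beta -/g /k; field.
  by [].
- by rewrite -[RHS]Ps PE.
(* The point is nonzero: at both ends by the sign of [N], elsewhere because [v] has a nonzero
   coefficient and is independent of [p] and [q]. *)
have [->|s0] := eqVneq s 0.
  rewrite expr0n mulr0 mul0r subr0 expr1n !scale0r !addr0 scale1r.
  by apply: contraTneq Np => ->; rewrite qform0 ltxx.
have [->|s1] := eqVneq s 1.
  rewrite subrr expr0n expr1n mulr1 mul1r !scale0r add0r addr0 scaler_eq0 negb_or k0 /=.
  by apply: contraTneq Nq => ->; rewrite qform0 ltxx.
by apply: nz; rewrite mulf_neq0 // subr_eq0 eq_sym.
Qed.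

End CommonZeros.

(** * Lagrange multiplier of one affine inequality on a convex set *)

Section LagrangeDuality.
Context {R : realType}.

Definition affine_map (V : lmodType R) (f : V -> R) :=
  forall (a b : R) X Y, a + b = 1 -> f (a *: X + b *: Y) = a * f X + b * f Y.

Definition convex_subset (V : lmodType R) (C : set V) :=
  forall (a b : R) X Y, 0 <= a -> 0 <= b -> a + b = 1 -> C X -> C Y ->
    C (a *: X + b *: Y).

(* The multiplier is the supremum of the ratios [- f Y / g Y] over [g Y > 0];
   the segment from [Y] to a point [Z] with [g Z < 0] meets [g = 0], which gives
   [- f Y / g Y <= - f Z / g Z]. *)
Lemma lagrange_multiplier (V : lmodType R) (C : set V) (f g : V -> R) :
  convex_subset C -> affine_map f -> affine_map g ->
  (exists Z, C Z /\ g Z < 0) -> (forall Y, C Y -> g Y <= 0 -> 0 <= f Y) ->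
  exists mu, 0 <= mu /\ forall Y, C Y -> 0 <= f Y + mu * g Y.
Proof.
move=> cC af ag [S [CS gS]] hf.
(* Adjoining [0] makes the set nonempty and its supremum nonnegative, even if [g] is never positive
   on [C]. *)
pose A := [set r : R | r = 0 \/ exists Y, [/\ C Y, 0 < g Y & r = - f Y / g Y]].
have Aub Z : C Z -> g Z < 0 -> ubound A (- f Z / g Z).
  move=> CZ gZ r [->|[Y [CY gY ->]]].
    by rewrite mulNr -mulrN -invrN mulr_ge0 ?invr_ge0 ?oppr_ge0 ?hf // ltW.
  have d0 : 0 < g Y - g Z by lra.
  have e1 : - g Z / (g Y - g Z) + g Y / (g Y - g Z) = 1 by field; lra.
  have a0 : 0 <= - g Z / (g Y - g Z) by rewrite divr_ge0 //; lra.
  have b0 : 0 <= g Y / (g Y - g Z) by rewrite divr_ge0 //; lra.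
  have := hf _ (cC _ _ _ _ a0 b0 e1 CY CZ).
  rewrite ag // af // (_ : _ + _ = 0) ?lexx; last by field; lra.
  move=> /(_ isT); rewrite (_ : _ + _ = (- g Z * f Y + g Y * f Z) / (g Y - g Z));
    last by field; lra.
  rewrite pmulr_lge0 ?invr_gt0 // => h.
  rewrite ler_pdivrMr // mulrAC ler_ndivlMr //; lra.
have A0 : A 0 by left.
have sA : has_sup A by split; [exists 0 | exists (- f S / g S); exact: Aub].
exists (sup A); split; first by apply: ub_le_sup => //; case: sA.
move=> Y CY; have [gY|gY|gY] := ltgtP (g Y) 0.
- have : sup A <= - f Y / g Y by apply: ge_sup; [case: sA | exact: Aub].
  rewrite ler_ndivlMr //; lra.
- have : - f Y / g Y <= sup A.
    by apply: ub_le_sup; [case: sA | right; exists Y].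
  rewrite ler_pdivrMr //; lra.
- by rewrite gY mulr0 addr0 hf // gY.
Qed.

End LagrangeDuality.

(** * Strong duality for semidefinite programs with two inequalities *)

Section ConicDuality.
Context {R : realType} {m : nat}.
Implicit Types (E M X Y Z : 'M[R]_m).

Lemma mxdot_affine M (c : R) : affine_map (fun Y => mxdot M Y + c).
Proof.
move=> a b X Y ab; rewrite mxdotDr !mxdotZr.
by rewrite -[in LHS](mulr1 c) -ab; ring.
Qed.

(** The inequalities are dualized one at a time: first [M2], with [M1] still a constraint, then [M1]
    on the slice [mxdot E Y = 1] of the cone. *)
Lemma sdp_strong_duality E M0 M1 M2 (v : R) :
  (forall x, 0 <= bform E x x) -> M0^T = M0 -> M1^T = M1 -> M2^T = M2 -> E^T = E ->
  (exists X, [/\ possemidefmx X, mxdot M1 X < 0, mxdot M2 X < 0 & mxdot E X = 1]) ->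
  (forall Y, possemidefmx Y -> mxdot E Y = 1 -> mxdot M1 Y <= 0 ->
    mxdot M2 Y <= 0 -> v <= mxdot M0 Y) ->
  exists y1 y2, [/\ 0 <= y1, 0 <= y2
    & possemidefmx (M0 - v *: E + y1 *: M1 + y2 *: M2)].
Proof.
move=> E0 s0 s1 s2 sE [S [pS S1 S2 SE]] hv.
have [|||||y2 [y20 h2]] := @lagrange_multiplier R _
  [set Y : 'M[R]_m | [/\ possemidefmx Y, mxdot E Y = 1 & mxdot M1 Y <= 0]]
  (fun Y => mxdot M0 Y + - v) (fun Y => mxdot M2 Y + 0).
- move=> a b X Y a0 b0 ab [pX EX X1] [pY EY Y1]; split.
  + by apply: psdD; apply: psdZ.
  + by rewrite mxdotDr !mxdotZr EX EY !mulr1.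
  + by rewrite mxdotDr !mxdotZr -[0]addr0 lerD // mulr_ge0_le0.
- exact: mxdot_affine.
- exact: mxdot_affine.
- by exists S; split; [split=> //; exact: ltW | rewrite addr0].
- by move=> Y [pY EY Y1] Y2; rewrite subr_ge0 hv //; move: Y2; rewrite addr0.
have [|||||y1 [y10 h1]] := @lagrange_multiplier R _
  [set Y : 'M[R]_m | possemidefmx Y /\ mxdot E Y = 1]
  (fun Y => mxdot (M0 + y2 *: M2) Y + - v) (fun Y => mxdot M1 Y + 0).
- move=> a b X Y a0 b0 ab [pX EX] [pY EY]; split.
  + by apply: psdD; apply: psdZ.
  + by rewrite mxdotDr !mxdotZr EX EY !mulr1.
- exact: mxdot_affine.
- exact: mxdot_affine.
- by exists S; split; [split | rewrite addr0].
- move=> Y [pY EY]; rewrite addr0 => Y1; have := h2 Y (And3 pY EY Y1).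
  by rewrite mxdotDl mxdotZl; lra.
exists y1, y2; split=> //.
set W := _ + y2 *: M2.
have WE Y : mxdot W Y = mxdot M0 Y - v * mxdot E Y + y1 * mxdot M1 Y + y2 * mxdot M2 Y.
  by rewrite /W !mxdotDl mxdotNl !mxdotZl.
(* Rescaling to the slice extends the bound by homogeneity. *)
have hW Y : possemidefmx Y -> 0 < mxdot E Y -> 0 <= mxdot W Y.
  move=> pY EY; have EY0 : 0 <= (mxdot E Y)^-1 by rewrite invr_ge0 ltW.
  have := h1 ((mxdot E Y)^-1 *: Y).
  rewrite /= mxdotDl !mxdotZl !mxdotZr mulVf ?gt_eqF // => h.
  have := h (conj (psdZ EY0 pY) erefl).
  rewrite -(pmulr_rge0 _ EY) WE => /le_trans; apply.
  by rewrite le_eqVlt; apply/orP; left; apply/eqP; field; rewrite gt_eqF.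
apply: psdP; first by rewrite /W !linearD linearN !linearZ /= s0 s1 s2 sE.
(* Starting from [S] keeps the value of [E] positive even when [E] vanishes at [x]; large [s] then
   reveals the sign of [W] at [x]. *)
move=> x; apply: (@affine_nonneg _ (mxdot W S)) => s s_ge0.
have -> : mxdot W S + s * bform W x x = mxdot W (S + s *: (x *m x^T)).
  by rewrite mxdotDr mxdotZr mxdot_outer.
apply: hW; first by apply: psdD => //; apply: psdZ => //; exact: psd_outer.
by rewrite mxdotDr mxdotZr mxdot_outer SE ltr_pwDl // mulr_ge0.
Qed.

End ConicDuality.

(** * Consequences of complementary slackness *)

Section ComplementarySolutions.
Context {R : realType} {m : nat}.
Context (M1 M2 X Z : 'M[R]_m) (y1 : R).
Context (pX : possemidefmx X) (pZ : possemidefmx Z) (ZX : mxdot Z X = 0).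

Lemma mxdot_eq0_submx : (X <= kermx Z)%MS.
Proof.
have [ps [_ XE]] := psd_gram pX; apply/sub_kermxP.
rewrite XE /gram mulmx_suml big_seq big1 // => p pin.
rewrite -mulmxA -[Z]psd_sym // -trmx_mul (@psd_gram_ker _ _ Z ps p) ?trmx0 ?mulmx0 //.
by rewrite -XE.
Qed.

(** [kermx] consists of row vectors killed by right multiplication by [Z]; symmetry of [Z]
    translates this to columns. *)
Lemma col_kerP (x : 'cV[R]_m) : reflect (Z *m x = 0) (x^T <= kermx Z)%MS.
Proof.
apply: (iffP sub_kermxP) => [h|h].
  by rewrite -[Z *m x]trmxK trmx_mul psd_sym // h trmx0.
by rewrite -[Z]psd_sym // -trmx_mul h trmx0.
Qed.

Context (sM1 : M1^T = M1) (sM2 : M2^T = M2) (X0 : X != 0).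

(** In a decomposition of [X] with equal values of [M1], every vector inherits the sign and the
    slackness of [mxdot M1 X]. The values of [M2] have a nonpositive sum, so one of them is
    nonpositive. *)
Lemma slack_zero : mxdot M1 X <= 0 -> mxdot M2 X <= 0 -> y1 * mxdot M1 X = 0 ->
  exists x, [/\ x != 0, Z *m x = 0, bform M1 x x <= 0, bform M2 x x <= 0
    & y1 * bform M1 x x = 0].
Proof.
move=> X1 X2 yX1.
have [ps [sps XE]] := psd_gram pX.
have r0 : (size ps)%:R != 0 :> R by rewrite sps pnatr_eq0 mxrank_eq0.
set d := mxdot M1 X / (size ps)%:R.
have d0 : d <= 0 by rewrite mulr_le0_ge0 ?invr_ge0 ?ler0n.
have [|qs [sqs gqs hqs]] := equalize_gram (d := d) (ps := ps) sM1.
  rewrite big_split /= sumrN big_const_seq count_predT iter_addr addr0.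
  by rewrite -mxdot_gram -XE -mulr_natr /d divfK ?subrr.
have qin : exists2 q, q \in qs & bform M2 q q <= 0.
  apply: contrapT => nq.
  have qpos q : q \in qs -> 0 < bform M2 q q.
    by move=> qin; rewrite ltNge; apply/negP => h; apply: nq; exists q.
  move: X2 sqs r0; rewrite XE -gqs mxdot_gram; case: qs qpos {gqs hqs nq} => [|q qs] qpos.
    by move=> _ <-; rewrite eqxx.
  rewrite big_cons big_seq => h _ _.
  have : 0 < bform M2 q q by rewrite qpos ?mem_head.
  have : 0 <= \sum_(i <- qs | i \in qs) bform M2 i i.
    by apply: sumr_ge0 => i iin; rewrite ltW // qpos // inE iin orbT.
  lra.
case: qin => q qin q2; exists q; split=> //.
- by apply: gram_nonzero qin; rewrite gqs sqs -XE.
- by apply: psd_gram_ker qin => //; rewrite gqs -XE.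
- by rewrite hqs.
- by rewrite hqs // /d mulrA yX1 mul0r.
Qed.

Lemma tight_rank2 : mxdot M1 X = 0 -> mxdot M2 X = 0 ->
  (forall x, x != 0 -> Z *m x = 0 -> bform M1 x x = 0 -> bform M2 x x = 0 -> False) ->
  [/\ \rank Z = (m - 2)%N, \rank X = 2%N
    & exists x1 x2 : 'cV[R]_m,
      [/\ X = x1 *m x1^T + x2 *m x2^T,
          mxdot M1 (x1 *m x1^T) = 0 /\ mxdot M1 (x2 *m x2^T) = 0,
          mxdot M2 (x1 *m x1^T) * mxdot M2 (x2 *m x2^T) < 0
        & mxdot M1 (x1 *m x2^T) != 0]].
Proof.
move=> X1 X2 nozero.
have [ps [sps XE]] := psd_gram pX.
have [|qs [sqs gqs hqs]] := equalize_gram (d := 0) (ps := ps) sM1.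
  rewrite big_split /= sumrN big_const_seq count_predT iter_addr addr0 mul0rn.
  by rewrite -mxdot_gram -XE subr0.
have szqs : size qs = \rank X by rewrite sqs.
have XEq : X = gram qs by rewrite gqs.
have q0 q : q \in qs -> q != 0 by apply: gram_nonzero; rewrite -XEq.
have qZ q : q \in qs -> Z *m q = 0 by apply: psd_gram_ker => //; rewrite -XEq.
have qN q : q \in qs -> bform M2 q q != 0.
  move=> qin; apply/eqP => h; apply: (nozero q) => //; [exact: q0|exact: qZ|exact: hqs].
have sumq : \sum_(q <- qs) bform M2 q q = 0 by rewrite -mxdot_gram -XEq.
have [q qin] : exists q, q \in qs.
  case: qs szqs {sqs gqs hqs XEq q0 qZ qN sumq} => [|q qs] szqs; last first.
    by exists q; rewrite mem_head.
  by move: X0; rewrite -mxrank_eq0 -szqs.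
have [p1 p1in p1neg] : exists2 p, p \in qs & bform M2 p p < 0.
  apply: contrapT => np; have h r : r \in qs -> 0 <= bform M2 r r.
    by move=> rin; rewrite leNgt; apply/negP => ?; apply: np; exists r.
  move/eqP: sumq; rewrite big_seq psumr_eq0 // => /allP/(_ q qin).
  by rewrite qin (negPf (qN q qin)).
have [p2 p2in p2pos] : exists2 p, p \in qs & 0 < bform M2 p p.
  apply: contrapT => np; have h r : r \in qs -> 0 <= - bform M2 r r.
    by move=> rin; rewrite oppr_ge0 leNgt; apply/negP => ?; apply: np; exists r.
  move/eqP: sumq; rewrite -oppr_eq0 -sumrN big_seq psumr_eq0 // => /allP/(_ q qin).
  by rewrite qin oppr_eq0 (negPf (qN q qin)).
have Zcomb a b x y : Z *m x = 0 -> Z *m y = 0 -> Z *m (a *: x + b *: y) = 0.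
  by move=> hx hy; rewrite mulmxDr -!scalemxAr hx hy !scaler0 addr0.
(* Otherwise [M1] would vanish on the plane of [p1] and [p2], where [M2] changes sign. *)
have beta0 : bform M1 p1 p2 != 0.
  apply/eqP => h; have [s [n0 z1 z2]] :=
    common_zero_plane sM1 sM2 (hqs _ p1in) (hqs _ p2in) h p1neg p2pos.
  apply: nozero n0 _ z1 z2.
  by rewrite -[p1]scale1r Zcomb // qZ.
(* A third dimension would provide a row of [kermx Z] outside the span of [p1] and [p2], hence a
   common zero. *)
have rker : (\rank (kermx Z) <= 2)%N.
  rewrite leqNgt; apply/negP => r3.
  have : ~~ (kermx Z <= col_mx p1^T p2^T)%MS.
    apply: contraL r3 => /mxrankS h; rewrite -leqNgt (leq_trans h) //.
    exact: (rank_leq_row (col_mx p1^T p2^T)).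
  case/row_subPn => i ni; set w := (row i (kermx Z))^T.
  have Zw : Z *m w = 0 by apply/col_kerP; rewrite trmxK row_sub.
  have wind a b : w != a *: p1 + b *: p2.
    apply: contraNneq ni => wE.
    rewrite -[row i _]trmxK -/w wE linearD !linearZ /= addmx_sub // scalemx_sub //.
      by rewrite -addsmxE addsmxSl.
    by rewrite -addsmxE addsmxSr.
  have [a [b [c [n0 z1 z2]]]] := common_zero_space sM1 sM2
    (hqs _ p1in) (hqs _ p2in) beta0 p1neg p2pos wind.
  apply: nozero n0 _ z1 z2.
  by rewrite -[_ + _ *: p2]scale1r Zcomb // Zcomb // qZ.
have p12 : p1 != p2.
  by apply: contraTneq p1neg => ->; rewrite -leNgt ltW.
(* The decomposition has exactly [\rank X] vectors, two of which are distinct. *)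
have rX2 : (2 <= \rank X)%N.
  rewrite -szqs; apply: (@uniq_leq_size _ [:: p1; p2]); first by rewrite /= inE p12.
  by move=> z; rewrite !inE => /orP[] /eqP->.
have rXk := mxrankS mxdot_eq0_submx.
have rX : \rank X = 2%N by apply/eqP; rewrite eqn_leq rX2 (leq_trans rXk).
have rk : \rank (kermx Z) = 2%N by apply/eqP; rewrite eqn_leq rker -{1}rX.
split=> //.
  by rewrite -rk mxrank_ker subKn // rank_leq_row.
exists p1, p2; rewrite !mxdot_outer !hqs //; split=> //; last by rewrite nmulr_rlt0.
have : size qs = 2 by rewrite szqs.
rewrite XEq; case: qs p1in p2in {sqs gqs hqs szqs XEq q0 qZ qN sumq qin} => [|a [|b []]] //=.
rewrite !inE /gram !big_cons big_nil addr0.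
by move=> /orP[]/eqP e1 /orP[]/eqP e2 _; move: p12; rewrite e1 e2 ?eqxx // addrC.
Qed.

End ComplementarySolutions.

(** * Absence of common zeros in the kernel under Property I+ *)

Section Converse.
Context {R : realType} {m : nat}.

(** By equality of ranks [ker Z] is the range of [X], so [x = a x1 + b x2]. Then [M1] gives
    [2 a b (x1^T M1 x2) = 0], hence [a = 0] or [b = 0], and [M2], nonzero at [x1] and [x2], kills
    the other coefficient. *)
Lemma tight_only_zero (M1 M2 X Z : 'M[R]_m) (x1 x2 x : 'cV[R]_m) :
  possemidefmx Z -> M1^T = M1 -> M2^T = M2 -> mxdot Z X = 0 ->
  \rank (kermx Z) = 2%N -> \rank X = 2%N -> X = x1 *m x1^T + x2 *m x2^T ->
  bform M1 x1 x1 = 0 -> bform M1 x2 x2 = 0 ->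
  bform M2 x1 x1 * bform M2 x2 x2 < 0 -> bform M1 x1 x2 != 0 ->
  Z *m x = 0 -> bform M1 x x = 0 -> bform M2 x x = 0 -> x = 0.
Proof.
move=> pZ s1 s2 ZX rZ rX XE h1 h2 h12 b12 Zx xM1 xM2.
have XEg : X = gram [:: x1; x2] by rewrite /gram !big_cons big_nil addr0.
have pX : possemidefmx X by rewrite XEg; exact: gram_psd.
have sub := mxdot_eq0_submx pX pZ ZX.
have ksub : (kermx Z <= X)%MS by rewrite -(mxrank_leqif_sup sub) rX rZ.
have /(submx_trans)/(_ ksub)/submxP[u uE] : (x^T <= kermx Z)%MS by apply/col_kerP.
have [a [b xE]] : exists a b, x = a *: x1 + b *: x2.
  exists ((u *m x1) 0 0), ((u *m x2) 0 0).
  rewrite -[x]trmxK uE XE mulmxDr !mulmxA linearD /= !trmx_mul !trmxK.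
  by rewrite -!trmx_mul [u *m x1]mx11_scalar [u *m x2]mx11_scalar !tr_scalar_mx
    !mul_mx_scalar !mxE eqxx.
move: xM1 xM2; rewrite xE !qform_comb // h1 h2 !mulr0 addr0 add0r => /eqP.
rewrite !mulf_eq0 pnatr_eq0 (negPf b12) orbF /= => /orP[]/eqP->.
  rewrite expr0n !mulr0 !mul0r !add0r scale0r add0r => /eqP; rewrite mulf_eq0 sqrf_eq0.
  by case/orP=> /eqP h; [rewrite h scale0r | move: h12; rewrite h mulr0 ltxx].
rewrite expr0n !mulr0 !mul0r !addr0 scale0r addr0 => /eqP; rewrite mulf_eq0 sqrf_eq0.
by case/orP=> /eqP h; [rewrite h scale0r | move: h12; rewrite h mul0r ltxx].
Qed.

End Converse.

(** * Continuity, minima on boxes and coordinate bounds *)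

Section Compactness.
Context {R : realType} {m : nat}.

Lemma bform_tr_continuous (M : 'M[R]_m) :
  continuous (fun v : 'rV[R]_m => bform M v^T v^T).
Proof.
have -> : (fun v : 'rV[R]_m => bform M v^T v^T)
    = fun v => \sum_i (\sum_j v 0 j * M j i) * v 0 i.
  apply/funext => v; rewrite /bform trmxK mxE; apply: eq_bigr => i _.
  by rewrite !mxE.
move=> v; apply: (@cvg_big R _ +%R 0 xpredT (@add_continuous R) _ (nbhs v) _
  (fun i (w : 'rV[R]_m) => (\sum_j w 0 j * M j i) * w 0 i)) => i _.
apply: cvgM; last exact: coord_continuous.
apply: (@cvg_big R _ +%R 0 xpredT (@add_continuous R) _ (nbhs v) _
  (fun j (w : 'rV[R]_m) => w 0 j * M j i)) => j _.
apply: cvgM; [exact: coord_continuous | exact: cvg_cst].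
Qed.

Lemma penalty_continuous (Z M1 M2 E : 'M[R]_m) :
  continuous (fun v : 'rV[R]_m => bform Z v^T v^T + `|bform M1 v^T v^T|
    + `|bform M2 v^T v^T| + `|bform E v^T v^T - 1|).
Proof.
move=> v; have cb M := @bform_tr_continuous M v.
(* The neighborhoods of matrices carried by [v] have no canonical [Filter] instance. *)
have FF : Filter (nbhs v) := @nbhs_filter 'rV[R]_m v.
apply: (@cvgD _ _ _ _ FF); last first.
  apply: (@cvg_norm _ _ _ _ FF); apply: (@cvgB _ _ _ _ FF); first exact: cb.
  exact: (@cvg_cst _ _ _ _ FF).
apply: (@cvgD _ _ _ _ FF); last exact: (@cvg_norm _ _ _ _ FF _ _ (cb M2)).
apply: (@cvgD _ _ _ _ FF); last exact: (@cvg_norm _ _ _ _ FF _ _ (cb M1)).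
exact: cb.
Qed.

Lemma positive_min_on_box (G : 'cV[R]_m -> R) (C : R) :
  continuous (fun v : 'rV[R]_m => G v^T) -> (forall x, 0 < G x) ->
  exists mu, 0 < mu /\ forall x : 'cV[R]_m, (forall i, `|x i 0| <= C) -> mu <= G x.
Proof.
move=> cG Gpos.
set B := [set v : 'rV[R]_m | forall i, `[(- C), C]%classic (v ord0 i)].
have memB (x : 'cV[R]_m) : (forall i, `|x i 0| <= C) -> B x^T.
  by move=> h i /=; rewrite in_itv /= -ler_norml mxE.
(* The box can be empty, as [C] may be negative; any positive [mu] then works. *)
have [B0|] := pselect (B !=set0); last first.
  by move=> nB; exists 1; split=> // x /memB hx; exfalso; apply: nB; exists x^T.
have cB : compact B
  by apply: (@rV_compact _ _ (fun=> `[(- C), C]%classic)) => i; exact: segment_compact.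
have [c _ hc] := EVT_min_rV B0 cB (continuous_subspaceT cG).
exists (G c^T); split=> // x /memB hx.
by have := hc _ (mem_set hx); rewrite trmxK.
Qed.

Lemma posdef_unitmx (P : 'M[R]_m) : posdefmx P -> P \in unitmx.
Proof.
move=> [_ hP]; rewrite -row_free_unit -kermx_eq0; apply/rowV0P => u /sub_kermxP uP.
apply/eqP; apply: contraT => u0.
have := hP u^T; rewrite trmx_eq0 => /(_ u0).
by rewrite trmxK uP mul0mx mxE ltxx.
Qed.

(** The vector [g] represents the [i]-th coordinate for the form [P], so nonnegativity at [x + g]
    and [x - g] bounds it on both sides. Summing over the diagonal of the inverse makes [D]
    independent of [i]. *)
Lemma posdef_coord_bound (P : 'M[R]_m) : posdefmx P ->
  exists D, forall (x : 'cV[R]_m) i, 2 * `|x i 0| <= bform P x x + D.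
Proof.
move=> pP; have uP := posdef_unitmx pP; have psd_P := posdef_psd pP.
have sP := psd_sym psd_P.
exists (\sum_i `|invmx P i i|) => x i.
have Di : invmx P i i <= \sum_i `|invmx P i i|.
  by rewrite (bigD1 i) //= ler_wpDr ?ler_norm // sumr_ge0.
pose g : 'cV[R]_m := invmx P *m delta_mx i 0.
have Pg : P *m g = delta_mx i 0 by rewrite /g mulmxA mulmxV // mul1mx.
have Pxg : bform P x g = x i 0.
  by rewrite /bform -mulmxA Pg -colE !mxE.
have Pgg : bform P g g = invmx P i i.
  by rewrite /bform -mulmxA Pg -colE mxE /g -colE !mxE.
have key s : 0 <= bform P x x + 2 * s * x i 0 + s ^+ 2 * invmx P i i.
  have := psd_P.2 (1 *: x + s *: g); rewrite -/(bform _ _ _) qform_comb //.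
  by rewrite Pxg Pgg expr1n mul1r mulr1.
have := key 1; have := key (- 1); rewrite sqrrN expr1n !mul1r => h1 h2.
have [_|_] := ler0P (x i 0); lra.
Qed.

End Compactness.

(** * Homogenized quadratic functions as forms on vectors [(t, z)] *)

Section Homogenization.
Context {R : realType} {n : nat}.

Lemma bform_qmx (Q : 'M[R]_n) (b : 'cV[R]_n) (c t : R) (z : 'cV[R]_n) :
  bform (qmx Q b c) (col_mx t%:M z) (col_mx t%:M z)
  = (z^T *m Q *m z) 0 0 + 2 * t * (b^T *m z) 0 0 + t ^+ 2 * c.
Proof.
rewrite /bform /qmx -mulmxA mul_block_col tr_col_mx mul_row_col tr_scalar_mx.
rewrite !mulmxDr !mul_scalar_mx mul_mx_scalar -?scalemxAr mulmxA !mxE eqxx mulr1n.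
rewrite [\sum_j _ * b j 0](_ : _ = \sum_j b^T 0 j * z j 0); first by ring.
by apply: eq_bigr => j _; rewrite !mxE mulrC.
Qed.

Lemma bform_I00 (t : R) (z : 'cV[R]_n) :
  bform I00 (col_mx t%:M z) (col_mx t%:M z) = t ^+ 2.
Proof.
rewrite (_ : I00 = qmx 0 0 1); last by rewrite /qmx trmx0.
by rewrite bform_qmx mulmx0 mul0mx trmx0 mul0mx !mxE; ring.
Qed.

Lemma cV_homogeneous (x : 'cV[R]_(1 + n)) : exists t z, x = col_mx t%:M z.
Proof.
by exists (usubmx x 0 0), (dsubmx x); rewrite -mx11_scalar vsubmxK.
Qed.

Lemma tr_qmx (Q : 'M[R]_n) b c : Q \is symmetricmx -> (qmx Q b c)^T = qmx Q b c.
Proof.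
by move=> /symmetricmxP sQ; rewrite /qmx tr_block_mx tr_scalar_mx trmxK sQ.
Qed.

Lemma tr_I00 : (I00 : 'M[R]_(1 + n))^T = I00.
Proof. by rewrite /I00 tr_block_mx tr_scalar_mx !trmx0. Qed.

Lemma bform_I00_ge0 (x : 'cV[R]_(1 + n)) : 0 <= bform I00 x x.
Proof. by have [t [z ->]] := cV_homogeneous x; rewrite bform_I00 sqr_ge0. Qed.

End Homogenization.

(** * Optimal values and complementary slackness of optimal pairs *)

Lemma min_value_minimizer (R : realType) (T : Type) (F : set T) (c : T -> R) x :
  minimizer F c x -> min_value F c = (c x)%:E.
Proof.
move=> [Fx hx]; apply/le_anti/andP; split.
  by apply: ereal_inf_lbound; exists x.
by apply/ereal_infP => _ [y Fy <-]; rewrite lee_fin hx.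
Qed.

Section OptimalPair.
Context {R : realType} {n : nat} (M0 M1 M2 : 'M[R]_(1 + n)).

(** Strong duality gives [mxdot M0 X <= y0], while dual feasibility writes [mxdot M0 X - y0] as a
    sum of three nonnegative terms; all of them vanish. *)
Lemma optimal_pair_complementary X Z y0 y1 y2 :
  M0^T = M0 -> M1^T = M1 -> M2^T = M2 ->
  (exists S, [/\ posdefmx S, mxdot M1 S < 0, mxdot M2 S < 0 & mxdot I00 S = 1]) ->
  optimal_pairs M0 M1 M2 (X, (Z, y0, y1, y2)) ->
  [/\ y0 = mxdot M0 X, mxdot Z X = 0, y1 * mxdot M1 X = 0 & y2 * mxdot M2 X = 0].
Proof.
move=> s0 s1 s2 [S [/posdef_psd pS S1 S2 SE]] [/= [[X1 X2 XE pX] Xmin]].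
move=> [[dE y1_ge0 y2_ge0 pZ] dmax].
have [||W1 [W2 [W1_ge0 W2_ge0 pW]]] :=
  @sdp_strong_duality R _ I00 M0 M1 M2 (mxdot M0 X) bform_I00_ge0 s0 s1 s2 tr_I00.
- by exists S.
- by move=> Y pY EY Y1 Y2; exact: Xmin.
have h : mxdot M0 X <= y0.
  apply: (dmax (M0 - mxdot M0 X *: I00 + W1 *: M1 + W2 *: M2, mxdot M0 X, W1, W2)); split=> //.
  by move: (mxdot _ X) I00 => v E; apply/matrixP => i j; rewrite !mxE; ring.
have ZX : 0 <= mxdot Z X.
  have [ps [_ ->]] := psd_gram pX; rewrite mxdot_gram sumr_ge0 // => p _; exact: pZ.2.
have yX1 := mulr_ge0_le0 y1_ge0 X1; have yX2 := mulr_ge0_le0 y2_ge0 X2.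
have : mxdot M0 X = y0 - y1 * mxdot M1 X - y2 * mxdot M2 X + mxdot Z X.
  by rewrite -[in LHS]dE !(mxdotDl, mxdotNl, mxdotZl) XE mulr1.
by move=> e; split; lra.
Qed.

Lemma sd_bform Z y0 y1 y2 x : y0 *: I00 - y1 *: M1 - y2 *: M2 + Z = M0 ->
  bform M0 x x = y0 * bform I00 x x - y1 * bform M1 x x - y2 * bform M2 x x
    + bform Z x x.
Proof. by move=> <-; rewrite !(bformDm, bformNm, bformZm). Qed.

End OptimalPair.

(** * Equivalence of a positive gap with Property I+ *)

Theorem theorem3p2 (R : realType) (n : nat) (hn : (1 <= n)%N)
    (Q0 Q1 Q2 : 'M[R]_n) (b0 b1 b2 : 'cV[R]_n) (c1 c2 : R)
    (hQ0 : Q0 \is symmetricmx) (hQ1 : Q1 \is symmetricmx)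
    (hQ2 : Q2 \is symmetricmx) :
  let M0 := qmx Q0 b0 0 in
  let M1 := qmx Q1 b1 c1 in
  let M2 := qmx Q2 b2 c2 in
  (exists X : 'M[R]_(1 + n),
    [/\ posdefmx X, mxdot M1 X < 0, mxdot M2 X < 0 & mxdot I00 X = 1]) ->
  (exists y0 y1 y2 : R,
    [/\ 0 < y1, 0 < y2
      & posdefmx (M0 - y0 *: I00 + y1 *: M1 + y2 *: M2)]) ->
  forall (X Z : 'M[R]_(1 + n)) (y0 y1 y2 : R),
    optimal_pairs M0 M1 M2 (X, (Z, y0, y1, y2)) ->
    (min_value (sp_feasible M1 M2) (sp_cost M0)
       < min_value (qp_feasible Q1 Q2 b1 b2 c1 c2) (qp_cost Q0 b0))%E
    <-> property_Iplus M1 M2 (X, (Z, y0, y1, y2)).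
Proof.
move=> M0 M1 M2 slaterP slaterD X Z y0 y1 y2 opt.
have s0 : M0^T = M0 by exact: tr_qmx.
have s1 : M1^T = M1 by exact: tr_qmx.
have s2 : M2^T = M2 by exact: tr_qmx.
have [y0E ZX yX1 yX2] := optimal_pair_complementary s0 s1 s2 slaterP opt.
have {slaterD} [u0 [u1 [u2 [u1_gt0 u2_gt0 pP]]]] := slaterD.
set P := _ + u2 *: M2 in pP.
have PE x : bform P x x = bform M0 x x - u0 * bform I00 x x + u1 * bform M1 x x
    + u2 * bform M2 x x.
  by rewrite /P !(bformDm, bformNm, bformZm).
have [/= Xopt [[dE y1_ge0 y2_ge0 pZ] _]] := opt.
have [[X1 X2 XE pX] _] := Xopt.
have X0 : X != 0.
  by apply: contra_eqN XE => /eqP ->; rewrite mxdot0r eq_sym oner_eq0.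
rewrite (min_value_minimizer Xopt) /sp_cost -y0E.
have costE t z : qp_cost Q0 b0 (z, t) = bform M0 (col_mx t%:M z) (col_mx t%:M z).
  by rewrite bform_qmx mulr0 addr0.
have feasE t z : qp_feasible Q1 Q2 b1 b2 c1 c2 (z, t) <->
    [/\ bform M1 (col_mx t%:M z) (col_mx t%:M z) <= 0,
        bform M2 (col_mx t%:M z) (col_mx t%:M z) <= 0
      & t ^+ 2 = 1].
  by rewrite !bform_qmx.
split=> [gap|[y12 rZ rX [x1 [x2 [XE12 [h1 h2] h12 b12]]]]].
  (* Such an [x], scaled to first coordinate [1], would be a point of (QP) of cost [y0], closing the
     gap. *)
  have nogood x : x != 0 -> Z *m x = 0 -> bform M1 x x <= 0 -> bform M2 x x <= 0 ->
      y1 * bform M1 x x = 0 -> y2 * bform M2 x x = 0 -> False.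
    move=> x0 Zx q1 q2 yq1 yq2.
    have M0x : bform M0 x x = y0 * bform I00 x x.
      by rewrite (sd_bform x dE) yq1 yq2 (bform_kerr x Zx) !subr0 addr0.
    have [t [z xE]] := cV_homogeneous x.
    have Ex : bform I00 x x = t ^+ 2 by rewrite xE bform_I00.
    (* If [t = 0], then [P] at [x] reduces to its [u1] and [u2] terms, both nonpositive, against
       definiteness. *)
    have [t0|t0] := eqVneq t 0.
      have := pP.2 x x0; rewrite -/(bform _ _ _) PE M0x Ex t0 expr0n !mulr0 subr0 add0r.
      have := mulr_ge0_le0 (ltW u1_gt0) q1; have := mulr_ge0_le0 (ltW u2_gt0) q2; lra.
    have sx : t^-1 *: x = col_mx 1%:M (t^-1 *: z).
      by rewrite xE scale_col_mx scale_scalar_mx mulVf.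
    have it : 0 <= t^-1 * t^-1 by rewrite -expr2 sqr_ge0.
    have feas : qp_feasible Q1 Q2 b1 b2 c1 c2 (t^-1 *: z, 1).
      apply/feasE; rewrite -sx !bformZl !bformZr !mulrA !mulr_ge0_le0 // expr1n.
      by split.
    move: gap; apply/negP; rewrite -leNgt; apply: ereal_inf_lbound.
    exists (t^-1 *: z, 1) => //; congr (_ %:E).
    by rewrite costE -sx bformZl bformZr M0x Ex; field.
  have y1n0 : y1 != 0.
    (* With [y1 = 0] only the slackness of [M2] has to be inherited, so [M2] is the form to
       equalize. *)
    apply/eqP => e1; have [x [n0 Zx q2 q1 yq2]] :=
      slack_zero pX pZ ZX s2 X0 X2 X1 yX2.
    by apply: nogood n0 Zx q1 q2 _ yq2; rewrite e1 mul0r.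
  have y2n0 : y2 != 0.
    apply/eqP => e2; have [x [n0 Zx q1 q2 yq1]] :=
      slack_zero pX pZ ZX s1 X0 X1 X2 yX1.
    by apply: nogood n0 Zx q1 q2 yq1 _; rewrite e2 mul0r.
  have MX1 : mxdot M1 X = 0 by move/eqP: yX1; rewrite mulf_eq0 (negPf y1n0) => /eqP.
  have MX2 : mxdot M2 X = 0 by move/eqP: yX2; rewrite mulf_eq0 (negPf y2n0) => /eqP.
  have [|rZ rX dec] := tight_rank2 pX pZ ZX s1 s2 X0 MX1 MX2.
    by move=> x n0 Zx q1 q2; apply: nogood n0 Zx _ _ _ _; rewrite ?q1 ?q2 ?mulr0.
  by split=> //; rewrite mulf_neq0.
rewrite !mxdot_outer in h1 h2 h12 b12.
have y1_gt0 : 0 < y1.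
  by rewrite lt_neqAle y1_ge0 eq_sym andbT; apply: contraNneq y12 => ->; rewrite mul0r.
have y2_gt0 : 0 < y2.
  by rewrite lt_neqAle y2_ge0 eq_sym andbT; apply: contraNneq y12 => ->; rewrite mulr0.
(* This is [(1 + n) - (n - 1) = 2], valid for truncated subtraction because [n >= 1]. *)
have rker : \rank (kermx Z) = 2%N.
  rewrite mxrank_ker rZ; case: (n) hn => // k _.
  by rewrite subn1 /= add1n subSn ?subSn ?subnn // ltnW.
(* A zero of [G] would be a common zero of [M1] and [M2] in [ker Z], hence [0], where the last term
   equals [1]. *)
pose G (x : 'cV[R]_(1 + n)) := bform Z x x + `|bform M1 x x| + `|bform M2 x x|
  + `|bform I00 x x - 1|.
have Gpos x : 0 < G x.
  rewrite ltNge; apply/negP; rewrite /G => Gx.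
  have Zx0 := pZ.2 x; rewrite -/(bform _ _ _) in Zx0.
  have a1 := normr_ge0 (bform M1 x x); have a2 := normr_ge0 (bform M2 x x).
  have a3 := normr_ge0 (bform I00 x x - 1).
  have Zx : bform Z x x = 0 by lra.
  have q1 : bform M1 x x = 0 by apply/eqP; rewrite -normr_le0; lra.
  have q2 : bform M2 x x = 0 by apply/eqP; rewrite -normr_le0; lra.
  have := tight_only_zero pZ s1 s2 ZX rker rX XE12 h1 h2 h12 b12 (psd_ker pZ Zx) q1 q2.
  move=> xz; move: Gx; rewrite xz !qform0 normr0 sub0r normrN normr1; lra.
have cG : continuous (fun v : 'rV[R]_(1 + n) => G v^T).
  exact: penalty_continuous.
have [D hD] := posdef_coord_bound pP.
(* The box contains every feasible point of cost at most [y0 + 1], since [P] is at most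
   [y0 + 1 - u0] there. *)
have [mu [mu_gt0 hmu]] := positive_min_on_box ((y0 + 1 - u0 + D) / 2) cG Gpos.
(* [k] is at most each weight of [Z], [M1] and [M2] in the excess of the cost over [y0], so this
   excess is at least [k * G] at feasible points. *)
set k := Num.min 1 (Num.min y1 y2).
have [k1 ky1 ky2] : [/\ k <= 1, k <= y1 & k <= y2].
  by rewrite /k !ge_min !lexx !orbT.
have k_gt0 : 0 < k by rewrite !lt_min ltr01 y1_gt0.
apply: (@lt_le_trans _ _ (y0 + Num.min 1 (k * mu))%:E).
  by rewrite lte_fin ltrDl lt_min ltr01 mulr_gt0.
apply/ereal_infP => _ [[z t] /feasE[q1 q2 t1] <-]; rewrite costE lee_fin.
set x := col_mx _ z in q1 q2 *.
have Ex : bform I00 x x = 1 by rewrite bform_I00.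
(* Points costing more than [y0 + 1] are covered by the [1] in the margin, the others by the minimum
   [mu] of [G] on the box. *)
have [small|] := lerP (bform M0 x x) (y0 + 1); last first.
  by move=> big; rewrite (le_trans _ (ltW big)) // lerD2l ge_min lexx.
have box i : `|x i 0| <= (y0 + 1 - u0 + D) / 2.
  have := hD x i; rewrite PE Ex.
  have := mulr_ge0_le0 (ltW u1_gt0) q1; have := mulr_ge0_le0 (ltW u2_gt0) q2; lra.
have := hmu x box; rewrite /G Ex subrr normr0 addr0 !ler0_norm // => muG.
have Zx0 := pZ.2 x; rewrite -/(bform _ _ _) in Zx0.
have e := sd_bform x dE; rewrite Ex in e.
have m1 : Num.min 1 (k * mu) <= k * mu by rewrite ge_min lexx orbT.
nra.
Qed.
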